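(* Let $a,b>0$ with $-a<1-b<a$, let $X^*=(x^*,y^* )$ be a fixed equilibrium of the Lozi system $x_{n+1}=y_n+1-a|x_n|$, $y_{n+1}=bx_n$, and let $0<R<|x^*|$. Then there exist constants $\alpha_*=\alpha_*(R)\in[0,1)$ and $\beta_*=\beta_*(R)\in[0,1)$ such that, for any sequences $\alpha_n\in(\alpha_*,1)$, $\beta_n\in(\beta_*,1)$, $n\in\mathbb N_0$, and any initial value $(x_0,y_0)\in B_R(X^* )$, the solution of $$x_{n+1}=\alpha_n x^*+(1-\alpha_n)(y_n+1-a|x_n|),\qquad y_{n+1}=\beta_n y^*+(1-\beta_n)bx_n,\qquad n\in\mathbb N_0,$$ converges to $(x^*,y^* )$.
   Context: $\mathbb N_0=\{0\}\cup\mathbb N$; $\|\cdot\|$ is a fixed (arbitrary) norm on $\mathbb R^2$ and $B_R(X^* )=\{X\in\mathbb R^2:\|X-X^*\|<R\}$. The equilibria of the Lozi system are $(x^*,y^* )=\left(\frac{1}{1\pm a-b},\,bx^*\right)$. *)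

(* Defs.v *)
From mathcomp Require Import all_boot all_order all_algebra.
From mathcomp Require Import all_classical all_reals all_analysis.

Set Implicit Arguments.
Unset Strict Implicit.
Unset Printing Implicit Defensive.

Import Order.TTheory GRing.Theory Num.Theory.
Import numFieldNormedType.Exports.

Local Open Scope classical_set_scope.
Local Open Scope ring_scope.

(* R^o is R seen as a module over itself, so that the product is a
   normed R-module; its topology is the usual topology of the plane. *)
Definition plane (R : realType) : normedModType R := (R^o * R^o)%type.

Definition is_norm (R : realType) (N : plane R -> R) : Prop :=
  [/\ forall X, N X = 0 -> X = 0,
      forall (c : R) X, N (c *: X) = `|c| * N X &
      forall X Y, N (X + Y) <= N X + N Y].

Definition norm_ball (R : realType) (N : plane R -> R) (Xs : plane R) (r : R)
    : set (plane R) :=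
  [set X | N (X - Xs) < r].

Definition lozi (R : realType) (a b : R) (X : plane R) : plane R :=
  (X.2 + 1 - a * `|X.1|, b * X.1).

Definition equilibrium (R : realType) (f : plane R -> plane R) (Xs : plane R)
    : Prop :=
  f Xs = Xs.

Definition controlled_lozi (R : realType) (a b : R) (Xs : plane R)
    (alpha beta : R) (X : plane R) : plane R :=
  (alpha * Xs.1 + (1 - alpha) * (lozi a b X).1,
   beta * Xs.2 + (1 - beta) * (lozi a b X).2).

Definition controlled_solution (R : realType) (a b : R) (Xs : plane R)
    (alpha beta : nat -> R) (X : nat -> plane R) : Prop :=
  forall n, X n.+1 = controlled_lozi a b Xs (alpha n) (beta n) (X n).

(* Main.v *)
Require Import Defs.
From mathcomp Require Import all_boot all_order all_algebra.
From mathcomp Require Import all_classical all_reals all_analysis.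
From mathcomp Require Import ring lra.
Import Order.TTheory GRing.Theory Num.Theory.
Import numFieldNormedType.Exports.
Local Open Scope classical_set_scope.
Local Open Scope ring_scope.

(** The absolute value is 1-Lipschitz, so the Lozi map is globally Lipschitz:
    in the sum distance [l1_dist] the constant is at most [1 + a + b].  The
    control pulls the image of the Lozi map towards the equilibrium [Xs], which
    that map fixes, and thereby multiplies the deviation of each coordinate from
    [Xs] by [1 - alpha] and [1 - beta] respectively.  Once both factors are
    below [q], one step multiplies [l1_dist _ Xs] by at most [q * (1 + a + b)]
    ([controlled_lozi_l1_dist]).  Taking [q := (2 * (1 + a + b))^-1], the
    distance is at least halved at every step, whatever the controls in the
    allowed range, so that the solution converges geometrically
    ([cvg_geometric_dist]). *)

(** The sum distance makes the Lipschitz estimate a plain addition of the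
    two coordinate estimates, and it dominates the max norm carried by
    [plane R]. *)
Definition l1_dist (R : realType) (X Y : plane R) : R :=
  `|X.1 - Y.1| + `|X.2 - Y.2|.

Lemma norm_le_l1_dist (R : realType) (X Y : plane R) :
  `|X - Y| <= l1_dist R X Y.
Proof.
by rewrite /l1_dist prod_normE /= ge_max lerDl lerDr !normr_ge0.
Qed.

(** The contraction is asked of a majorant [d] of the distance to the limit,
    so that it may be measured in another norm than that of the space. *)
Lemma cvg_geometric_dist (R : realType) (V : normedModType R) (u : nat -> V)
    (l : V) (d : nat -> R) (k : R) :
    0 <= k < 1 ->
    (forall n, `|u n - l| <= d n) ->
    (forall n, d n.+1 <= k * d n) ->
  u @ \oo --> l.
Proof.
move=> /andP[k0 k1] u_le_d d_contr.
have d_le n : d n <= geometric (d 0%N) k n.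
  elim: n => [|n IHn] /=; first by rewrite expr0 mulr1.
  apply: le_trans (d_contr n) _.
  by rewrite exprS mulrCA ler_wpM2l.
have geo0 : geometric (d 0%N) k @ \oo --> 0.
  by apply: cvg_geometric; rewrite ger0_norm.
apply/cvgrPdist_le => e e_gt0.
move/cvgrPdist_le: geo0 => /(_ e e_gt0); apply: filterS => n.
rewrite sub0r normrN distrC; apply: le_trans.
exact: le_trans (u_le_d n) (le_trans (d_le n) (ler_norm _)).
Qed.

(** The terms of the Lozi map that are constant cancel when the fixed-point
    equation of [Xs] is subtracted; the term [a * `|X.1|] is the only nonlinear
    one, and the reverse triangle inequality bounds it. *)
Lemma controlled_lozi_l1_dist (R : realType) (a b : R) (Xs : plane R)
    (q alpha beta : R) (X : plane R) :
    0 < a -> 0 < b -> equilibrium (lozi a b) Xs ->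
    1 - q < alpha < 1 -> 1 - q < beta < 1 ->
  l1_dist R (controlled_lozi a b Xs alpha beta X) Xs
    <= q * (1 + a + b) * l1_dist R X Xs.
Proof.
case: Xs X => [xs ys] [x y] a0 b0 [xsE ysE] /andP[qal al1] /andP[qbe be1].
rewrite /l1_dist /controlled_lozi /lozi /=.
have -> : alpha * xs + (1 - alpha) * (y + 1 - a * `|x|) - xs
    = (1 - alpha) * ((y - ys) - a * (`|x| - `|xs|)).
  by rewrite -[in LHS]xsE; ring.
have -> : beta * ys + (1 - beta) * (b * x) - ys
    = (1 - beta) * (b * (x - xs)).
  by rewrite -ysE; ring.
have al0 : 0 <= 1 - alpha by lra.
have be0 : 0 <= 1 - beta by lra.
rewrite !normrM !(ger0_norm al0) (ger0_norm be0) (gtr0_norm b0).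
have x_lip : `|(y - ys) - a * (`|x| - `|xs|)| <= `|y - ys| + a * `|x - xs|.
  apply: le_trans (ler_normB _ _) _.
  by rewrite lerD2l normrM (gtr0_norm a0) ler_pM2l// ler_dist_dist.
have q0 : 0 <= q by lra.
have xs_ge0 := normr_ge0 (x - xs); have ys_ge0 := normr_ge0 (y - ys).
have x_step : (1 - alpha) * `|(y - ys) - a * (`|x| - `|xs|)|
    <= q * (`|y - ys| + a * `|x - xs|).
  by apply: ler_pM => //; lra.
have y_step : (1 - beta) * (b * `|x - xs|) <= q * (b * `|x - xs|).
  by apply: ler_wpM2r; [rewrite mulr_ge0// ltW | lra].
apply: le_trans (lerD x_step y_step) _.
rewrite -mulrDr -mulrA ler_wpM2l//.
have := mulr_ge0 (ltW a0) ys_ge0; have := mulr_ge0 (ltW b0) ys_ge0.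
lra.
Qed.

Theorem proposition2p5 (R : realType) (N : plane R -> R) (hN : is_norm N)
    (a b : R) (ha : 0 < a) (hb : 0 < b) (hab : - a < 1 - b < a)
    (Xs : plane R) (hXs : equilibrium (lozi a b) Xs)
    (r : R) (hr : 0 < r < `|Xs.1|) :
  exists alphas betas : R,
    [/\ 0 <= alphas < 1,
        0 <= betas < 1 &
        forall alpha beta : nat -> R,
          (forall n, alphas < alpha n < 1) ->
          (forall n, betas < beta n < 1) ->
          forall X : nat -> plane R,
            norm_ball N Xs r (X 0%N) ->
            controlled_solution a b Xs alpha beta X ->
            X @ \oo --> Xs].
Proof.
(* Any value below the inverse of the Lipschitz bound [1 + a + b] contracts;
   half of it gives the ratio [1 / 2]. *)
pose q : R := (2 * (1 + a + b))^-1.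
have q_gt0 : 0 < q by rewrite invr_gt0; lra.
have q_half : q * (1 + a + b) = 2^-1 by rewrite /q; field; lra.
have q_le1 : q <= 1 by rewrite invf_le1; lra.
exists (1 - q), (1 - q); split; [lra | lra |].
move=> alpha beta alphaP betaP X _ X_sol.
apply: (@cvg_geometric_dist _ _ _ _ (fun n => l1_dist R (X n) Xs) 2^-1).
- lra.
- by move=> n; exact: norm_le_l1_dist.
- by move=> n; rewrite X_sol -q_half; exact: controlled_lozi_l1_dist.
Qed.
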